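(* Let $n,d\in\mathbb N$. A map $F:\mathbb C\langle X_n\rangle^{*d}\to\mathbb C$ is generating of degree $n$ and index $d$ if and only if $F$ is a polynomial function over $\mathbb C\langle X_n\rangle^d$ given by a polynomial in $\mathbb C[\langle X_n\rangle\times[d]]$ which lies in the linear span $\mathbb C\,\mathcal M_d(n)$ of $\mathcal M_d(n)$; that is, if and only if there are constants $\alpha_\pi\in\mathbb C$ ($\pi\in\mathcal M_d(n)$) with $$F(\varphi)=\sum_{\pi\in\mathcal M_d(n)}\alpha_\pi\,\mathrm S(\varphi)(\pi)=\sum_{\pi\in\mathcal M_d(n)}\alpha_\pi\prod_{(M,l)\in\pi}\varphi^{(l)}(M)\qquad\text{for all }\varphi=(\varphi^{(1)},\dots,\varphi^{(d)})\in\mathbb C\langle X_n\rangle^{*d}.$$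
   Context: Vector spaces are complex; algebras are complex associative, not necessarily unital. $[d]=\{1,\dots,d\}$, $X_n=\{x_1,\dots,x_n\}$. For a set $X$, $\langle X\rangle$ is the free semigroup on $X$ (words of length $\ge1$), $\mathbb C\langle X\rangle$ its semigroup algebra (non-commutative polynomials without constant term), $[Y]$ is the free commutative monoid on a set $Y$ and $\mathbb C[Y]$ the commutative unital polynomial algebra. For a word $M=y_1\cdots y_k$: $\mathrm{set}\,M=\{y_1,\dots,y_k\}$, $|M|=k$. For a vector space $V$, $V^{*d}:=(V^* )^d=(V^d)^*$ ($V^*$ the algebraic dual). For $\varphi=(\varphi^{(1)},\dots,\varphi^{(d)})\in V^{*d}$ and linear $j:W\to V$, $\varphi\circ j:=(\varphi^{(1)}\circ j,\dots,\varphi^{(d)}\circ j)\in W^{*d}$. For elements $a_1,\dots,a_n$ of an algebra $A$, $j(a_1,\dots,a_n):\mathbb C\langle X_n\rangle\to A$ is the algebra homomorphism with $x_i\mapsto a_i$. $F:\mathbb C\langle X_n\rangle^{*d}\to\mathbb C$ is called generating (of degree $n$ and index $d$) if for each algebra $A$ and each $\varphi\in A^{*d}$ the map $A^n\to\mathbb C$, $(a_1,\dots,a_n)\mapsto F(\varphi\circ j(a_1,\dots,a_n))$ is $n$-linear. $\mathrm S(V)$ is the (unital) symmetric tensor algebra of $V$; for $\varphi\in V^*$, $\mathrm S(\varphi):\mathrm S(V)\to\mathbb C$ is the unital algebra homomorphism extending $\varphi$. A polynomial function over $V$ is a map $V^*\to\mathbb C$ of the form $\varphi\mapsto\mathrm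 S(\varphi)(P)$, $P\in\mathrm S(V)$ (the function is said to be given by $P$). One identifies $\mathrm S(\mathbb C\langle X_n\rangle^d)=\mathbb C[\langle X_n\rangle\times[d]]$, with $\mathrm S(\varphi)((M,l))=\varphi^{(l)}(M)$. For a finite set $X$, $\mathcal M(X)$ is the set of elements $M_1\cdot\ldots\cdot M_l$ of $[\langle X\rangle]$ with $|M_1|+\dots+|M_l|=\#X$, the sets $\mathrm{set}\,M_r$ pairwise disjoint and $\#\,\mathrm{set}\,M_r=|M_r|$ (each indeterminate occurs exactly once). $\mathcal M_d(X)=\{(M_1,k_1)\cdot\ldots\cdot(M_l,k_l): M_1\cdot\ldots\cdot M_l\in\mathcal M(X),\ k_1,\dots,k_l\in[d]\}\subset[\langle X\rangle\times[d]]$, and $\mathcal M_d(n)=\mathcal M_d(X_n)$. $(M,l)\in\pi$ means that $(M,l)$ is a factor of $\pi$. *)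

(* Defs.v *)
From HB Require Import structures.
From mathcomp Require Import all_boot all_order all_algebra finmap.
From mathcomp Require Import monalg complex.
From mathcomp Require Import boolp classical_sets functions cardinality fsbigop.
From mathcomp Require Import reals.

Set Implicit Arguments.
Unset Strict Implicit.
Unset Printing Implicit Defensive.

Import GRing.Theory.
Local Open Scope ring_scope.

(* Associative algebras without a unit; the algebras of mathcomp are unital. *)
HB.mixin Record Lmodule_isNonUnitalAlgebra (K : fieldType) A
    of GRing.Lmodule K A := {
  nmul : A -> A -> A;
  nmulA : associative nmul;
  nmulDl : left_distributive nmul +%R;
  nmulDr : right_distributive nmul +%R;
  nmulZl : forall (k : K) (x y : A), nmul (k *: x) y = k *: nmul x y;
  nmulZr : forall (k : K) (x y : A), nmul x (k *: y) = k *: nmul x y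
}.

#[short(type="nuAlgType")]
HB.structure Definition NonUnitalAlgebra (K : fieldType) :=
  {A of GRing.Lmodule K A & Lmodule_isNonUnitalAlgebra K A}.

Section Words.
Variable X : choiceType.

Record word : predArgType := Word { wseq :> seq X; _ : wseq != [::] }.

HB.instance Definition _ := [isSub for wseq].
HB.instance Definition _ := [Choice of word by <:].

Lemma wcat_subproof (M N : word) : M ++ N != [::] :> seq X.
Proof. by case: M => -[]. Qed.

Definition wcat (M N : word) : word := Word (wcat_subproof M N).

Definition letter (x : X) : word := @Word [:: x] isT.

Lemma wcatA : associative wcat.
Proof. by move=> L M N; apply: val_inj; rewrite /= catA. Qed.

End Words.

Definition wset (X : finType) (M : word X) : {set X} := [set x in wseq M].

Section LinearExtension.
Variables (K : fieldType) (W : choiceType) (V : lmodType K) (h : W -> V).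

Definition malg_lift (g : {malg K[W]}) : V := \sum_(k <- msupp g) g@_k *: h k.

Lemma malg_liftEw (E : {fset W}) (g : {malg K[W]}) :
  (msupp g `<=` E)%fset -> malg_lift g = \sum_(k <- E) g@_k *: h k.
Proof.
move=> le; rewrite /malg_lift (big_fset_incl _ le) //= => x xE /mcoeff_outdom ->.
by rewrite scale0r.
Qed.

Lemma malg_lift_is_linear : linear malg_lift.
Proof.
move=> c f g; set E := (msupp (c *: f + g) `|` (msupp f `|` msupp g))%fset.
have sE : [/\ (msupp (c *: f + g)%R `<=` E)%fset, (msupp f `<=` E)%fset
            & (msupp g `<=` E)%fset].
  split; first exact: fsubsetUl.
    by rewrite (fsubset_trans _ (fsubsetUr _ _)) // fsubsetUl.
  by rewrite (fsubset_trans _ (fsubsetUr _ _)) // fsubsetUr.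
case: sE => s1 s2 s3.
rewrite !(@malg_liftEw E) // scaler_sumr -big_split /=; apply: eq_bigr => k _.
by rewrite mcoeffD mcoeffZ scalerDl scalerA.
Qed.

HB.instance Definition _ :=
  GRing.isLinear.Build K {malg K[W]} V *:%R malg_lift malg_lift_is_linear.

Lemma malg_liftU k : malg_lift << k >> = h k.
Proof.
by rewrite (malg_liftEw msuppU_le) big_seq_fset1 mcoeffUU scale1r.
Qed.

End LinearExtension.

Lemma malg_linear_ext (K : fieldType) (W : choiceType) (V : lmodType K)
    (f g : {malg K[W]} -> V) :
  linear f -> linear g -> (forall k, f << k >> = g << k >>) -> f =1 g.
Proof.
move=> lf lg fg P.
pose f' : {linear {malg K[W]} -> V} := HB.pack f (GRing.isLinear.Build _ _ _ _ f lf).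
pose g' : {linear {malg K[W]} -> V} := HB.pack g (GRing.isLinear.Build _ _ _ _ g lg).
rewrite -[f P]/(f' P) -[g P]/(g' P) (monalgE P) !linear_sum.
apply: eq_bigr => k _.
have -> : << P@_k *g k >> = P@_k *: << k >> :> {malg K[W]}.
  by apply/malgP => l; rewrite mcoeffZ !mcoeffU mulr_natr.
by rewrite !linearZ /= fg.
Qed.

(* The semigroup algebra of the free semigroup on X. *)
Notation ncpoly K X := {malg K[word X]}.

Section SemigroupAlgebra.
Variables (K : fieldType) (X : choiceType).
Local Notation P := (ncpoly K X).
Implicit Types p q r : P.

Definition ncmul p q : P :=
  malg_lift (fun M => malg_lift (fun N => << wcat M N >> : P) q) p.

Lemma ncmulUU M N : ncmul << M >> << N >> = << wcat M N >>.
Proof. by rewrite /ncmul !malg_liftU. Qed.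

Lemma ncmulDl : left_distributive ncmul +%R.
Proof. by move=> p q r; rewrite /ncmul linearD. Qed.

Lemma ncmulDr : right_distributive ncmul +%R.
Proof.
move=> p q r; rewrite /ncmul /malg_lift -big_split /=.
by apply: eq_bigr => M _; rewrite -!/(malg_lift _ _) linearD scalerDr.
Qed.

Lemma ncmulZl c p q : ncmul (c *: p) q = c *: ncmul p q.
Proof. by rewrite /ncmul linearZ. Qed.

Lemma ncmulZr c p q : ncmul p (c *: q) = c *: ncmul p q.
Proof.
rewrite /ncmul /malg_lift scaler_sumr; apply: eq_bigr => M _.
by rewrite -!/(malg_lift _ _) linearZ /= !scalerA mulrC.
Qed.

Lemma ncmulA : associative ncmul.
Proof.
move=> p q r.
apply: (malg_linear_ext (f := fun p => ncmul p (ncmul q r))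
                        (g := fun p => ncmul (ncmul p q) r)) => [c u v|c u v|L].
- by rewrite ncmulDl ncmulZl.
- by rewrite ncmulDl ncmulZl ncmulDl ncmulZl.
apply: (malg_linear_ext (f := fun q => ncmul << L >> (ncmul q r))
          (g := fun q => ncmul (ncmul << L >> q) r)) => [c u v|c u v|M].
- by rewrite ncmulDl ncmulZl ncmulDr ncmulZr.
- by rewrite ncmulDr ncmulZr ncmulDl ncmulZl.
apply: (malg_linear_ext (f := fun r => ncmul << L >> (ncmul << M >> r))
          (g := fun r => ncmul (ncmul << L >> << M >>) r)) => [c u v|c u v|N].
- by rewrite ncmulDr ncmulZr ncmulDr ncmulZr.
- by rewrite ncmulDr ncmulZr.
by rewrite !ncmulUU wcatA.
Qed.

HB.instance Definition _ := Lmodule_isNonUnitalAlgebra.Build K P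
  ncmulA ncmulDl ncmulDr ncmulZl ncmulZr.

End SemigroupAlgebra.

(* The algebra homomorphism j(a) from ncpoly K X, see jhom_unique. *)
Section Substitution.
Variables (K : fieldType) (X : choiceType) (A : nuAlgType K) (a : X -> A).

(* The value at [::] is irrelevant: words are nonempty. *)
Definition word_eval (M : word X) : A :=
  if wseq M is x :: s then foldl (fun b y => nmul b (a y)) (a x) s else 0.

Definition jhom : ncpoly K X -> A := malg_lift word_eval.

HB.instance Definition _ := GRing.Linear.on jhom.

Lemma jhom_letter x : jhom << letter x >> = a x.
Proof. by rewrite /jhom malg_liftU. Qed.

Lemma word_eval_cat M N : word_eval (wcat M N) = nmul (word_eval M) (word_eval N).
Proof.
have nmul_foldl s : forall b c : A,
    foldl (fun b y => nmul b (a y)) (nmul b c) s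
    = nmul b (foldl (fun b y => nmul b (a y)) c s).
  by elim: s => [//|y s IH] b c /=; rewrite -nmulA IH.
by case: M N => -[//|x s] ? [[//|y t] ?]; rewrite /word_eval /= foldl_cat /= nmul_foldl.
Qed.

Lemma jhomM p q : jhom (nmul p q) = nmul (jhom p) (jhom q).
Proof.
apply: (malg_linear_ext (f := fun p => jhom (nmul p q))
          (g := fun p => nmul (jhom p) (jhom q))) => [c u v|c u v|M].
- by rewrite nmulDl nmulZl linearP.
- by rewrite linearP nmulDl nmulZl.
apply: (malg_linear_ext (f := fun q => jhom (nmul << M >> q))
          (g := fun q => nmul (jhom << M >>) (jhom q))) => [c u v|c u v|N].
- by rewrite nmulDr nmulZr linearP.
- by rewrite linearP nmulDr nmulZr.
by rewrite [nmul _ _]ncmulUU /jhom !malg_liftU word_eval_cat.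
Qed.

Lemma jhom_unique (f : {linear ncpoly K X -> A}) :
  (forall p q, f (nmul p q) = nmul (f p) (f q)) ->
  (forall x, f << letter x >> = a x) -> f =1 jhom.
Proof.
move=> fM fX; apply: malg_linear_ext; [exact: linearP|exact: linearP|].
case=> s s0; rewrite /jhom malg_liftU.
case: s s0 => [//|x s]; elim/last_ind: s => [|s y IH] i.
  by rewrite (_ : Word i = letter x) ?fX //; apply: val_inj.
have -> : Word i = wcat (@Word _ (x :: s) isT) (letter y).
  by apply: val_inj; rewrite /= cats1.
by rewrite -ncmulUU [LHS]fM IH fX word_eval_cat.
Qed.

End Substitution.

(* Hence a function of scalar maps only depends on their values. *)
Lemma scalar_ext (K : fieldType) (V : lmodType K) (f g : {scalar V}) :
  f =1 g -> f = g.
Proof.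
case: f g => f [[hf] [kf]] [g [[hg] [kg]]] /= /funext fg.
by subst g; rewrite (Prop_irrelevance hf hg) (Prop_irrelevance kf kg).
Qed.

Definition multilinear (K : fieldType) (I : eqType) (A : lmodType K)
    (G : (I -> A) -> K) : Prop :=
  forall (i : I) (a : I -> A),
    scalar (fun x : A => G (@dfwith I (fun=> A) a i x)).

Definition generating (K : fieldType) (n d : nat)
    (F : ('I_d -> {scalar ncpoly K 'I_n}) -> K) : Prop :=
  forall (A : nuAlgType K) (phi : 'I_d -> {scalar A}),
    multilinear (fun a : 'I_n -> A => F (fun l => phi l \o jhom a)).

Section MonomialEvaluation.
Variables (K : fieldType) (Y : choiceType) (h : Y -> K).

Definition cm_eval (m : {cmonom Y}) : K := \prod_(y <- finsupp m) h y ^+ m y.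

Lemma cm_evalEw (E : {fset Y}) (m : {cmonom Y}) :
  (finsupp m `<=` E)%fset -> cm_eval m = \prod_(y <- E) h y ^+ m y.
Proof.
move=> le; rewrite /cm_eval (big_fset_incl _ le) //= => y _.
by rewrite -cmE_eq0 => /eqP ->; rewrite expr0.
Qed.

Lemma cm_eval_is_mmorphism : mmorphism cm_eval.
Proof.
split=> [m1 m2|]; last by rewrite /cm_eval mdom1 big_seq_fset0.
rewrite {1}/cm_eval mdomD (cm_evalEw (fsubsetUl _ (finsupp m2))).
rewrite (cm_evalEw (fsubsetUr (finsupp m1) _)) -big_split /=.
by apply: eq_bigr => y _; rewrite cmM exprD.
Qed.

HB.instance Definition _ :=
  isMultiplicative.Build {cmonom Y} K cm_eval cm_eval_is_mmorphism.

Lemma cm_evalU y : cm_eval (ucm y) = h y.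
Proof. by rewrite /cm_eval mdomU big_seq_fset1 cmUU expr1. Qed.

End MonomialEvaluation.

(* S(phi), on S(C<X>^d) identified with the commutative polynomial algebra in  *)
(* the indeterminates (M, l), M a word and l < d.                              *)
Definition Sdual (K : fieldType) (X : choiceType) (d : nat)
    (phi : 'I_d -> {scalar ncpoly K X}) :
    {malg K[{cmonom (word X * 'I_d)%type}]} -> K :=
  mmap idfun (cm_eval (fun y => phi y.2 << y.1 >>)).

HB.instance Definition _ (K : fieldType) (X : choiceType) (d : nat)
    (phi : 'I_d -> {scalar ncpoly K X}) :=
  GRing.LRMorphism.copy (Sdual phi)
    (mmap idfun (cm_eval (fun y => phi y.2 << y.1 >>))).

Lemma SdualU (K : fieldType) (X : choiceType) (d : nat)
    (phi : 'I_d -> {scalar ncpoly K X}) (M : word X) (l : 'I_d) :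
  Sdual phi << ucm (M, l) >> = phi l << M >>.
Proof. by rewrite /Sdual mmapU mul1r cm_evalU. Qed.

Definition cmprod (Y : choiceType) (s : seq Y) : {cmonom Y} :=
  \big[mmul/mone]_(y <- s) ucm y.

Lemma cmprodE (Y : choiceType) (s : seq Y) y : cmprod s y = count_mem y s.
Proof.
rewrite /cmprod; elim: s => [|x s IH]; first by rewrite big_nil cm1.
by rewrite big_cons cmM cmU IH.
Qed.

Lemma cmprod_inj (Y : choiceType) (s t : seq Y) :
  cmprod s = cmprod t -> perm_eq s t.
Proof. by move=> st; apply/allP => y _ /=; rewrite -!cmprodE st. Qed.

Definition each_letter_once (X : finType) (s : seq (word X)) : bool :=
  [&& \sum_(M <- s) size M == #|X|,
      pairwise (fun M N => [disjoint @wset X M & @wset X N]) s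
    & all (fun M => #|@wset X M| == size M) s]%N.

Local Open Scope classical_set_scope.

(* The elements of the free commutative monoid having some factorization as in *)
(* each_letter_once; by cmprod_inj the factorization is unique up to order.    *)
Definition calM (X : finType) : set {cmonom (word X)} :=
  [set cmprod s | s in [set` @each_letter_once X]].

Definition calMd (X : finType) (d : nat) :
    set {cmonom (word X * 'I_d)%type} :=
  [set cmprod s | s in [set s : seq (word X * 'I_d) |
    calM (cmprod [seq y.1 | y <- s])]].

Arguments calMd : clear implicits.

(* Sums \sum_(pi \in A) would be 0 by convention over an infinite support. *)
Lemma finite_calMd (X : finType) (d : nat) : finite_set (calMd X d).
Proof.
pose n := #|X|.
pose g (p : n.-bseq X * 'I_d) : option (word X * 'I_d) :=
  omap (fun w : word X => (w, p.2)) (insub (bseqval p.1)).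
pose f (t : n.-bseq (n.-bseq X * 'I_d)) := cmprod (pmap g t).
apply: (@sub_finite_set _ _ (range f)); last exact/finite_image/finite_finset.
move=> _ [s [s' /and3P[/eqP sz _ _] /cmprod_inj eqs] <-].
have {}sz : \sum_(y <- s) size y.1 = n.
  by rewrite -[RHS]sz (perm_big _ eqs) big_map.
have szle : forall y, y \in s -> (size y.1 <= n)%N.
  by move=> y ys; rewrite -sz (big_rem y) //= leq_addr.
have szs : (size s <= n)%N.
  rewrite -sz -sum1_size; apply: leq_sum => -[[w w0] l] _.
  by rewrite lt0n size_eq0.
pose r (y : word X * 'I_d) : n.-bseq X * 'I_d := (insub_bseq n (wseq y.1), y.2).
have gr y : y \in s -> g (r y) = Some y.
  move=> ys; rewrite /g /r /= /insub_bseq insubdK ?valK; last exact: szle.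
  by case: y {ys}.
have szr : (size (map r s) <= n)%N by rewrite size_map.
exists (Bseq szr) => //; rewrite /f /=; congr cmprod.
clear -gr; elim: s gr => [//|y s IH] gr /=.
rewrite (gr y) ?mem_head //= IH // => z zs.
by apply: gr; rewrite inE zs orbT.
Qed.

Definition linear_span (K : fieldType) (V : lmodType K) (S : set V) : set V :=
  [set v | exists (k : nat) (c : 'I_k -> K) (u : 'I_k -> V),
    (forall i, S (u i)) /\ v = \sum_(i < k) c i *: u i].

(* Main.v *)
(** The set of functions given by elements of the span of [calMd] is closed
    under sums, and each of its members is generating because every letter
    occurs exactly once. Conversely, let F be generating, and lift each pair
    (M, l) to a word in letters (x, j), j in a finite set J, by attaching marks
    to the letters of M. Transporting phi along the lift to a functional on the
    free semigroup algebra on X * J and substituting x |-> sum_j (x, j) leaves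
    phi unchanged, so n-linearity expands F phi as a sum over f : X -> J of F at
    the restriction of phi to the pairs (M, l) whose letters x are all marked
    f x. The mark consists of (M, l) and of a bit telling whether the letter
    occurs again later in M; hence for a given f the surviving words have
    distinct letters and are pairwise disjoint. Rescaling the letters then shows
    that F vanishes at this restriction if some letter is not covered by a
    surviving word, and otherwise equals the product of the values of phi on the
    surviving words times a constant. *)
Require Import Defs.
From HB Require Import structures.
From mathcomp Require Import all_boot all_order all_algebra finmap.
From mathcomp Require Import monalg complex.
From mathcomp Require Import boolp classical_sets cardinality fsbigop reals.

Set Implicit Arguments.
Unset Strict Implicit.
Unset Printing Implicit Defensive.

Import GRing.Theory.
Local Open Scope ring_scope.

(** * Functionals given by their values on a basis *)

Section ScalarLift.
Variables (K : fieldType) (W : choiceType).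

Definition malg_scalar (h : W -> K) : {malg K[W]} -> K :=
  @malg_lift K W K^o h.

HB.instance Definition _ (h : W -> K) :=
  GRing.isLinear.Build K {malg K[W]} K *%R (malg_scalar h)
    (@malg_lift_is_linear K W K^o h).

Lemma malg_scalarU h k : malg_scalar h << k >> = h k.
Proof. exact: (@malg_liftU K W K^o h k). Qed.

Lemma malg_scalar_ext (f g : {scalar {malg K[W]}}) :
  (forall k, f << k >> = g << k >>) -> f = g.
Proof.
move=> fg; apply: scalar_ext.
by apply: (@malg_linear_ext K W K^o f g _ _ fg) => c u v; rewrite linearP.
Qed.

End ScalarLift.

(** * Multilinear maps: scaling and expansion *)

Section Multilinear.
Variables (K : fieldType) (I : finType) (A : lmodType K).

Local Notation upd a i x := (@dfwith I (fun=> A) a i x).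

Section Slot.
Variables (G : (I -> A) -> K) (Glin : multilinear G) (i : I) (a : I -> A).

Let slot : {scalar A} := HB.pack (fun x : A => G (upd a i x))
  (GRing.isLinear.Build K A K *%R _ (Glin i a)).

Lemma multilinear_slotZ c x :
  G (upd a i (c *: x)) = c * G (upd a i x).
Proof. by rewrite -[LHS]/(slot _) linearZ. Qed.

Lemma multilinear_slot_sum (J : finType) (b : J -> A) :
  G (upd a i (\sum_j b j)) = \sum_j G (upd a i (b j)).
Proof. exact: (linear_sum slot). Qed.

End Slot.

Lemma multilinear_scale (G : (I -> A) -> K) (c : I -> K) (a : I -> A) :
  multilinear G -> G (fun i => c i *: a i) = \prod_i c i * G a.
Proof.
move=> Glin.
have main (s : seq I) : uniq s ->
    G (fun i => if i \in s then c i *: a i else a i) = \prod_(i <- s) c i * G a.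
  elim: s => [|i s IH] /=; first by rewrite big_nil mul1r.
  case/andP=> i_s us; rewrite big_cons -mulrA -IH //.
  set a' := fun k => if k \in s then _ else _.
  have -> : a' = upd a' i (a i).
    apply/funext => k; case: dfwithP => // {k}.
    by rewrite /a' (negPf i_s).
  rewrite -multilinear_slotZ //; congr G; apply/funext => k.
  rewrite inE; case: eqVneq => [->|ki] /=; first by rewrite dfwith_in.
  by rewrite dfwith_out // eq_sym.
rewrite -(main (index_enum I)) ?index_enum_uniq //.
by congr G; apply/funext => i; rewrite mem_index_enum.
Qed.

(* The parameter [t] and the class [E] of functions of [t]
   avoid an explicit sum over the functions [I -> J]. *)
Lemma multilinear_sum (T : Type) (G : T -> (I -> A) -> K) (J : finType)
    (b : I -> J -> A) (E : set (T -> K)) :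
  (forall t, multilinear (G t)) ->
  E (fun=> 0) -> (forall u v, E u -> E v -> E (fun t => u t + v t)) ->
  (forall f : I -> J, E (fun t => G t (fun i => b i (f i)))) ->
  E (fun t => G t (fun i => \sum_j b i j)).
Proof.
move=> Glin E0 ED Eb.
have Esum (h : J -> T -> K) : (forall j, E (h j)) -> E (fun t => \sum_j h j t).
  move=> Eh; elim: (index_enum J) => [|j r IH].
    by under eq_fun do rewrite big_nil.
  by under eq_fun do rewrite big_cons; apply: ED.
(* Slots in [s] carry the full sum, the others the summand chosen by [f]. Expanding one more slot
   amounts to updating [f] there. *)
have main (s : seq I) (f : I -> J) :
    E (fun t => G t (fun i => if i \in s then \sum_j b i j else b i (f i))).
  elim: s f => [|i s IH] f; first exact: Eb.
  have [i_s|i_s] := boolP (i \in s).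
    have := IH f; congr E; apply/funext => t; congr (G t); apply/funext => k.
    by rewrite inE; case: eqVneq => // ->; rewrite i_s.
  have := Esum _ (fun j => IH (@dfwith I (fun=> J) f i j)); congr E.
  apply/funext => t.
  pose a k := if k \in s then \sum_j b k j else b k (f k).
  transitivity (\sum_j G t (upd a i (b i j))).
    apply: eq_bigr => j _; congr (G t); apply/funext => k.
    case: dfwithP => [|{}k ik]; first by rewrite (negPf i_s) dfwith_in.
    by rewrite /a dfwith_out.
  rewrite -multilinear_slot_sum //; congr (G t); apply/funext => k.
  rewrite inE; case: eqVneq => [->|ki] /=; first by rewrite dfwith_in.
  by rewrite dfwith_out // eq_sym.
have [[f _]|noJ] := pselect (exists f : I -> J, True).
  have := main (index_enum I) f; congr E; apply/funext => t; congr (G t).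
  by apply/funext => i; rewrite mem_index_enum.
(* Without any function [I -> J], [J] is empty and [I] is not, so some slot holds an empty sum and
   [G t] vanishes. *)
have J0 (j : J) : False by apply: noJ; exists (fun=> j).
have [i _|I0] := pickP (@predT I); last first.
  by case: noJ; have g : I -> J by [move=> i; have := I0 i]; exists g.
move: E0; congr E; apply/funext => t.
rewrite -(mul0r (G t (upd (fun=> 0) i 0))).
rewrite -multilinear_slotZ // scale0r; congr (G t); apply/funext => k.
by case: dfwithP => *; rewrite big1.
Qed.

End Multilinear.

(** * Substitution into words *)

Section WordMap.
Variables X Y : choiceType.
Implicit Types (g : X -> Y) (M : word X).

Lemma word_map_subproof g M :
  map g M != [::].
Proof. by case: M => -[]. Qed.

Definition word_map g M : word Y :=
  Word (word_map_subproof g M).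

End WordMap.

Lemma word_map_id (X : choiceType) (M : word X) : word_map id M = M.
Proof. by apply: val_inj; rewrite /= map_id. Qed.

Section WordEval.
Variables (K : fieldType) (X : choiceType).

Lemma word_letter_ind (P : word X -> Prop) :
  (forall x, P (letter x)) -> (forall x M, P M -> P (wcat (letter x) M)) ->
  forall M, P M.
Proof.
move=> P1 Pcons [[//|x s]]; elim: s x => [|y s IH] x i.
  by rewrite (_ : Word i = letter x) //; apply: val_inj.
have -> : Word i = wcat (letter x) (@Word X (y :: s) isT) by apply: val_inj.
exact/Pcons/IH.
Qed.

Lemma word_eval_letter (A : nuAlgType K) (a : X -> A) x :
  word_eval a (letter x) = a x.
Proof. by []. Qed.

Lemma eq_in_word_eval (A : nuAlgType K) (a b : X -> A) (M : word X) :
  {in wseq M, a =1 b} -> word_eval a M = word_eval b M.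
Proof.
elim/word_letter_ind: M => [x|x M IH] ab; first by apply: ab; rewrite inE.
rewrite !word_eval_cat !word_eval_letter ab ?mem_head // IH // => y yM.
by apply: ab; rewrite inE yM orbT.
Qed.

(** As [i] occurs exactly once, a single factor of the product varies. *)
Lemma word_eval_slot_linear (A : nuAlgType K) (a : X -> A) (i : X)
    (M : word X) : uniq M -> i \in wseq M ->
  linear (fun x : A => word_eval (@dfwith X (fun=> A) a i x) M).
Proof.
elim/word_letter_ind: M => [x _|x M IH /= /andP[xM uM]].
  by rewrite inE => /eqP <- c u v; rewrite !word_eval_letter !dfwith_in.
rewrite inE; case: eqVneq => [-> _ c u v|ix /= iM c u v].
  rewrite !word_eval_cat !word_eval_letter !dfwith_in nmulDl nmulZl.
  by do 2?congr (_ + _); rewrite -?nmulZl; congr nmul;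
     apply: eq_in_word_eval => y yM; rewrite !dfwith_out //;
     apply: contraNneq xM => ->.
rewrite !word_eval_cat !word_eval_letter !dfwith_out // IH //.
by rewrite nmulDr nmulZr.
Qed.

Lemma word_eval_scaled_letters (Y : choiceType) (c : X -> K) (g : X -> Y) M :
  word_eval (fun x => c x *: << letter (g x) >> : ncpoly K Y) M
  = (\prod_(x <- wseq M) c x) *: << word_map g M >>.
Proof.
elim/word_letter_ind: M => [x|x M IH].
  rewrite word_eval_letter big_seq1; congr (_ *: << _ >>); exact: val_inj.
rewrite word_eval_cat word_eval_letter IH big_cons nmulZl nmulZr scalerA.
rewrite [nmul _ _]ncmulUU; congr (_ *: << _ >>); exact: val_inj.
Qed.

Lemma word_eval_letters (Y : choiceType) (g : X -> Y) M :
  word_eval (fun x => << letter (g x) >> : ncpoly K Y) M = << word_map g M >>.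
Proof.
have := word_eval_scaled_letters (fun=> 1) g M.
rewrite big1 // scale1r => <-.
by apply: eq_in_word_eval => x _; rewrite scale1r.
Qed.

(** Expanding the product of sums yields every lift of [M] once, and [phi] kills all of them but
    [w0]. *)
Lemma word_eval_sum_letters (J : finType) (M : word X)
    (w0 : word (X * J)%type) (phi : {scalar ncpoly K (X * J)%type}) :
  word_map fst w0 = M ->
  (forall w, word_map fst w = M -> w != w0 -> phi << w >> = 0) ->
  phi (word_eval (fun x => \sum_j << letter (x, j) >> : ncpoly K _) M)
  = phi << w0 >>.
Proof.
pose a x : ncpoly K (X * J)%type := \sum_j << letter (x, j) >>.
elim/word_letter_ind: M w0 phi => [x|x M IH] w0 phi w0M phi0.
  have [j0 w0E] : exists j0, w0 = letter (x, j0).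
    case: w0 w0M {phi0} => -[//|[y j] s] w0 [-> /eqP].
    rewrite -size_eq0 size_map size_eq0 => /eqP s0.
    by exists j; apply: val_inj; rewrite /= s0.
  rewrite word_eval_letter linear_sum (bigD1 j0) //= -w0E big1 ?addr0 //.
  move=> j jj0; apply: phi0; first exact: val_inj.
  by apply: contraNneq jj0; rewrite w0E => -[->].
have [j0 [w1 w0E]] : exists j0 w1, w0 = wcat (letter (x, j0)) w1.
  case: w0 w0M {phi0} => -[//|[y j] [|z s]] w0 [->].
    by case: M {IH} => -[].
  by move=> _; exists j, (@Word _ (z :: s) isT); apply: val_inj.
have w1M : word_map fst w1 = M.
  by move: w0M; rewrite w0E => -[?]; apply: val_inj.
rewrite word_eval_cat word_eval_letter.
(* The first marked letter is absorbed into the functional, so that the induction hypothesis applies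
   to the rest of the word. *)
pose phi_ j (p : ncpoly K (X * J)%type) := phi (nmul << letter (x, j) >> p).
have phi_lin j : scalar (phi_ j).
  by move=> c u v; rewrite /phi_ nmulDr nmulZr linearP.
pose psi j : {scalar ncpoly K (X * J)%type} :=
  HB.pack (phi_ j) (GRing.isLinear.Build _ _ _ _ _ (phi_lin j)).
have psiU j w : psi j << w >> = phi << wcat (letter (x, j)) w >>.
  by rewrite -[LHS]/(phi (ncmul _ _)) ncmulUU.
have psiE j : phi (nmul << letter (x, j) >> (word_eval a M))
            = phi << wcat (letter (x, j)) w1 >>.
  rewrite -psiU -[LHS]/(psi j _); apply: IH => // w wM ww1.
  rewrite psiU; apply: phi0; first by apply: val_inj; rewrite /= -wM.
  by apply: contraNneq ww1; rewrite w0E => -[_ ?]; apply/eqP/val_inj.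
have -> : nmul (\sum_j << letter (x, j) >>) (word_eval a M)
          = \sum_j nmul << letter (x, j) >> (word_eval a M).
  elim/big_rec2: _ => [|j u v _ <-]; last by rewrite nmulDl.
  by have := nmulZl (0 : K) (0 : ncpoly K _) (word_eval a M); rewrite !scale0r.
rewrite linear_sum (eq_bigr _ (fun j _ => psiE j)) (bigD1 j0) // -w0E.
rewrite big1 => [|j jj0]; [exact: addr0|apply: phi0].
  by apply: val_inj; rewrite /= -w1M.
by apply: contraNneq jj0; rewrite w0E => -[->].
Qed.

End WordEval.

(** * Monomials in which each letter occurs once *)

(** The two conditions on letter sets together say that the concatenation has no repetitions; having
    length [#|X|], it then enumerates [X]. *)
Lemma each_letter_onceE (X : finType) (s : seq (word X)) :
  each_letter_once s = perm_eq (flatten (map (@wseq X) s)) (enum X).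
Proof.
have uniqE : uniq (flatten (map (@wseq X) s)) =
    pairwise (fun M N => [disjoint @wset X M & @wset X N]) s
    && all (fun M => #|@wset X M| == size M) s.
  elim: s => //= M s IH; rewrite cat_uniq IH.
  have -> : uniq M = (#|wset M| == size M).
    by rewrite cardsE; apply/card_uniqP/eqP.
  have -> : ~~ has [in wseq M] (flatten [seq wseq i | i <- s]) =
            all (fun N => [disjoint wset M & wset N]) s.
    rewrite -all_predC; elim: {IH}s => //= N s <-; rewrite all_cat.
    congr (_ && _); rewrite disjoint_sym disjoint_subset.
    apply/allP/fintype.subsetP => h x.
      by rewrite !inE => /h.
    by move=> xN; have := h x; rewrite !inE; apply.
  by rewrite -!andbA; do !bool_congr.
have sizeE : (\sum_(M <- s) size M)%N = size (flatten (map (@wseq X) s)).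
  by rewrite size_flatten /shape -map_comp sumnE big_map.
rewrite /each_letter_once sizeE -uniqE.
apply/andP/idP => [[/eqP sz us]|p]; last first.
  by rewrite (perm_size p) (perm_uniq p) enum_uniq -cardE.
apply: uniq_perm => //; first exact: enum_uniq.
move=> x; rewrite mem_enum inE.
have /uniq_min_size : {subset flatten (map (@wseq X) s) <= enum X}.
  by move=> y; rewrite mem_enum.
by case=> //; [rewrite -cardE sz|move=> _ ->; rewrite mem_enum].
Qed.

Lemma calMdP (X : finType) (d : nat) pi :
  calMd X d pi <->
  exists2 s : seq (word X * 'I_d),
    perm_eq (flatten [seq wseq y.1 | y <- s]) (enum X) & pi = cmprod s.
Proof.
split=> [[s [s' s'1 /cmprod_inj ss'] <-]|[s s1 ->]].
  have : each_letter_once s' := s'1.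
  rewrite each_letter_onceE => s'X; exists s => //; apply: perm_trans s'X.
  by rewrite (map_comp (@wseq X)) perm_flatten // perm_map // perm_sym.
exists s => //; exists [seq y.1 | y <- s] => //.
suff: each_letter_once [seq y.1 | y <- s] by [].
by rewrite each_letter_onceE -map_comp.
Qed.

(** * The span of [calMd] and the functions it gives *)

Lemma linear_spanD (K : fieldType) (V : lmodType K) (S : set V) (u v : V) :
  linear_span S u -> linear_span S v -> linear_span S (u + v).
Proof.
move=> [k [c [p [Sp ->]]]] [l [e [q [Sq ->]]]].
exists (k + l)%N.
exists (fun i => match fintype.split i with inl i => c i | inr i => e i end).
exists (fun i => match fintype.split i with inl i => p i | inr i => q i end).
split=> [i|]; first by case: (fintype.split i).
rewrite big_split_ord; congr (_ + _); apply: eq_bigr => i _.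
  by rewrite -[lshift _ i]/(unsplit (inl i)) unsplitK.
by rewrite -[rshift _ i]/(unsplit (inr i)) unsplitK.
Qed.

Section Span.
Variables (K : fieldType) (X : finType) (d : nat).
Local Notation scalars := ('I_d -> {scalar ncpoly K X}).

Lemma Sdual_cmprod (phi : scalars) s :
  Sdual phi << cmprod s >> = \prod_(y <- s) phi y.2 << y.1 >>.
Proof.
rewrite /Sdual mmapU mul1r /cmprod.
elim: s => [|y s IH]; first by rewrite !big_nil mmorph1.
by rewrite !big_cons mmorphM /= IH cm_evalU.
Qed.

(** All exponents are 1, because a repeated factor would repeat its first letter in the
    concatenation. *)
Lemma calMd_finsupp_prod pi (h : word X * 'I_d -> K) :
  calMd X d pi -> cm_eval h pi = \prod_(y <- finsupp pi) h y.
Proof.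
case/calMdP => s s1 ->; rewrite /cm_eval; apply: eq_big_seq => y ys.
suff -> : cmprod s y = 1%N by rewrite expr1.
have : y \in s.
  by rewrite -has_pred1 has_count -cmprodE lt0n cmE_eq0 negbK.
rewrite cmprodE => {}ys; apply/eqP.
rewrite eqn_leq -has_count has_pred1 ys andbT.
case: y ys => -[[//|x w] w0] l ys.
have : (count_mem x (flatten [seq wseq y.1 | y <- s]) <= 1)%N.
  by rewrite (permP s1) count_uniq_mem ?enum_uniq // leq_b1.
apply: leq_trans; rewrite count_flatten sumnE !big_map.
rewrite -sum1_count big_mkcond; apply: leq_sum => y _ /=.
by case: eqP => // -> /=; rewrite eqxx.
Qed.

(** Stated as a set of functions so that it can serve as the class [E] of [multilinear_sum]. *)
Definition span_calMd : set (scalars -> K) :=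
  [set H | exists P : {malg K[{cmonom (word X * 'I_d)%type}]},
    linear_span [set << pi >> | pi in calMd X d]%classic P /\
    forall phi, H phi = Sdual phi P].

Lemma span_calMd0 : span_calMd (fun=> 0).
Proof.
exists 0; split => [|phi]; last by rewrite linear0.
by exists 0%N, (fun=> 0), (fun=> 0); split=> [[]|] //; rewrite big_ord0.
Qed.

Lemma span_calMdD u v :
  span_calMd u -> span_calMd v -> span_calMd (fun phi => u phi + v phi).
Proof.
move=> [P [SP uP]] [Q [SQ vQ]]; exists (P + Q).
split; first exact: linear_spanD.
by move=> phi; rewrite uP vQ linearD.
Qed.

Lemma span_calMdU c pi : calMd X d pi ->
  span_calMd (fun phi => c * Sdual phi << pi >>).
Proof.
move=> pi1; exists (c *: << pi >>); split; last by move=> phi; rewrite linearZ.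
exists 1%N, (fun=> c), (fun=> << pi >>); split; last by rewrite big_ord1.
by move=> _; exists pi.
Qed.

(** Exactly one factor contains the letter [i]; it is linear in that slot, and the other factors do
    not depend on it. *)
Lemma calMd_multilinear (A : nuAlgType K) (phi : 'I_d -> {scalar A}) pi :
  calMd X d pi ->
  multilinear (fun a : X -> A => Sdual (fun l => phi l \o jhom a) << pi >>).
Proof.
case/calMdP => s s1 -> i a.
have prodE (b : X -> A) : Sdual (fun l => phi l \o jhom b) << cmprod s >>
    = \prod_(y <- s) phi y.2 (word_eval b y.1).
  by rewrite Sdual_cmprod; apply: eq_bigr => y _; rewrite /= /jhom malg_liftU.
have : i \in flatten [seq wseq y.1 | y <- s].
  by rewrite (perm_mem s1) mem_enum.
case/flatten_mapP => y ys iy.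
have : uniq (flatten [seq wseq y.1 | y <- y :: rem y s]).
  rewrite -(perm_uniq (perm_flatten (perm_map _ (perm_to_rem ys)))).
  by rewrite (perm_uniq s1) enum_uniq.
rewrite /= cat_uniq => /and3P[uy /hasPn disj _] c u v /=.
rewrite !prodE !(big_rem y ys) /= word_eval_slot_linear // linearP.
have const x :
    \prod_(z <- rem y s) phi z.2 (word_eval (@dfwith X (fun=> A) a i x) z.1)
    = \prod_(z <- rem y s) phi z.2 (word_eval a z.1).
  apply: eq_big_seq => z zs; congr (phi _ _); apply: eq_in_word_eval => k kz.
  rewrite dfwith_out //; apply: contraTneq iy => ->; apply: disj.
  by apply/flatten_mapP; exists z.
rewrite !const.
by rewrite mulrDl mulrA.
Qed.

End Span.

Lemma span_calMd_generating (K : fieldType) (n d : nat)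
    (F : ('I_d -> {scalar ncpoly K 'I_n}) -> K) :
  span_calMd F -> generating F.
Proof.
move=> [P [[k [c [p [cp ->]]]] FE]] A phi i a t u v.
rewrite !FE !linear_sum mulr_sumr -big_split; apply: eq_bigr => r _ /=.
have [pi pi1 <-] := cp r.
rewrite !linearZ /= (calMd_multilinear phi pi1 i a) mulrDr; congr (_ + _).
by rewrite mulrCA.
Qed.

(** * Bits detecting repeated letters *)

Section RepeatFlags.
Variable T : eqType.
Implicit Types (s : seq T) (b : T -> bool).

Fixpoint repeat_flags s : seq (T * bool) :=
  if s is x :: t then (x, x \in t) :: repeat_flags t else [::].

Lemma repeat_flags_fst s : map fst (repeat_flags s) = s.
Proof. by elim: s => //= x s ->. Qed.

(** The last occurrence of a letter always gets the bit [false]; a bit depending on the letter alone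
    is then [false] at every occurrence, which excludes repetitions. *)
Lemma repeat_flags_eq s b :
  repeat_flags s = [seq (x, b x) | x <- s] <->
  uniq s /\ {in s, forall x, b x = false}.
Proof.
split=> [sb|[us b0]]; last first.
  elim: s us b0 => //= x s IH /andP[xs us] b0.
  rewrite (negPf xs) b0 ?mem_head // IH // => y ys.
  by rewrite b0 // inE ys orbT.
have mem_last x : x \in s -> (x, false) \in repeat_flags s.
  elim: s {sb} => //= y s IH; have [/IH xs _|xs] := boolP (x \in s).
    by rewrite inE xs orbT.
  by rewrite inE (negPf xs) orbF => /eqP <-; rewrite (negPf xs) mem_head.
have b0 : {in s, forall x, b x = false}.
  by move=> x /mem_last; rewrite sb => /mapP[y _ [-> ->]].
split=> //; elim: s sb b0 {mem_last} => //= x s IH [xs sb] b0.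
rewrite xs b0 ?mem_head //= IH // => y ys.
by rewrite b0 // inE ys orbT.
Qed.

End RepeatFlags.

(** * Two consequences of being generating *)

Section Generating.
Variables (K : fieldType) (n d : nat).
Local Notation X := 'I_n.
Local Notation scalars := ('I_d -> {scalar ncpoly K X}).
Variables (F : scalars -> K) (Fgen : generating F).

(** Multilinearity in the free semigroup algebra itself, at the substitution of each letter [x] by
    its multiple by [c x]. *)
Lemma generating_scale (c : X -> K) (phi : scalars) :
  F (fun l => malg_scalar (fun M => \prod_(x <- wseq M) c x * phi l << M >>))
  = \prod_i c i * F phi.
Proof.
have -> : F phi = F (fun l => phi l \o jhom (fun x => << letter x >>)).
  congr F; apply/funext => l; apply: malg_scalar_ext => M.
  by rewrite /= /jhom malg_liftU (word_eval_letters K id) word_map_id.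
rewrite -(multilinear_scale c _ (Fgen phi)).
congr F; apply/funext => l; apply: malg_scalar_ext => M.
rewrite /= malg_scalarU /jhom malg_liftU (word_eval_scaled_letters c id).
by rewrite linearZ word_map_id.
Qed.

(** Here [sec l] is any section of the map forgetting marks. The choice of marks that separates
    words is made afterwards. *)
Lemma generating_section (J : finType) (E : set (scalars -> K))
    (sec : 'I_d -> word X -> word (X * J)%type) :
  (forall l M, word_map fst (sec l M) = M) ->
  E (fun=> 0) -> (forall u v, E u -> E v -> E (fun phi => u phi + v phi)) ->
  (forall f : X -> J, E (fun phi => F (fun l => malg_scalar (fun M =>
    if sec l M == word_map (fun x => (x, f x)) M then phi l << M >>
    else 0)))) ->
  E F.
Proof.
move=> secK E0 ED EF.
(* This functional vanishes off the chosen lifts, so substituting for each letter the sum of its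
   marked copies gives back [phi]. *)
pose Phi (phi : scalars) l : {scalar ncpoly K (X * J)%type} :=
  malg_scalar (fun w =>
    if w == sec l (word_map fst w) then phi l << word_map fst w >> else 0).
pose G (phi : scalars) (a : X -> ncpoly K (X * J)%type) :=
  F (fun l => Phi phi l \o jhom a).
have -> : F = fun phi => G phi (fun x => \sum_j << letter (x, j) >>).
  apply/funext => phi; congr F; apply/funext => l; apply: malg_scalar_ext => M.
  rewrite /= /jhom malg_liftU (word_eval_sum_letters (secK l M)).
    by rewrite /Phi /= malg_scalarU secK eqxx.
  by move=> w wM wl; rewrite /Phi /= malg_scalarU wM (negPf wl).
apply: multilinear_sum => // [phi|f]; first exact: Fgen.
have := EF f; congr E; apply/funext => phi; congr F; apply/funext => l.
apply: malg_scalar_ext => M; rewrite /= malg_scalarU /jhom malg_liftU.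
rewrite (word_eval_letters K (fun x => (x, f x))).
rewrite /Phi /= malg_scalarU eq_sym.
by have -> : word_map fst (word_map (fun x => (x, f x)) M) = M
  by apply: val_inj; rewrite /= -map_comp map_id.
Qed.

End Generating.

(** * The marks of the letters of a word *)

Section WordMarking.
Variables n d : nat.
Local Notation X := 'I_n.
Local Notation J := (bool * n.-bseq X * 'I_d)%type.

Lemma marked_subproof (l : 'I_d) (M : word X) :
  [seq (p.1, (p.2, insub_bseq n (wseq M), l)) | p <- repeat_flags M] != [::].
Proof. by case: M => -[]. Qed.

(* On words without repeated letters, which have at most [n] letters,
   [insub_bseq n] is injective; longer words get the empty sequence. *)
Definition marked l M : word (X * J)%type := Word (marked_subproof l M).

Lemma marked_fst l M : word_map fst (marked l M) = M.
Proof.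
by apply: val_inj; rewrite /= -map_comp -[RHS]repeat_flags_fst.
Qed.

(** Within one word the marks differ only in their bits, so the question reduces to
    [repeat_flags_eq]. *)
Lemma marked_eqP (f : X -> J) l M :
  marked l M = word_map (fun x => (x, f x)) M <->
  uniq M /\ {in wseq M, forall x, f x = (false, insub_bseq n (wseq M), l)}.
Proof.
set m := insub_bseq n _.
split=> [/(congr1 (@wseq _)) /= E | [uM fM]]; last first.
  apply: val_inj; rewrite /= -/m.
  rewrite (_ : repeat_flags M = [seq (x, false) | x <- M]); last first.
    exact/repeat_flags_eq.
  by rewrite -map_comp; apply/eq_in_map => x /fM /= ->.
have mE : repeat_flags M = [seq (x, (f x).1.1) | x <- M].
  have := congr1 (map (fun p : X * J => (p.1, p.2.1.1))) E.
  rewrite -!map_comp => <-; rewrite -[LHS]map_id.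
  by apply: eq_map => -[].
case/repeat_flags_eq: (mE) => uM f0; split=> // x xM.
have : (x, f x) \in [seq (x, f x) | x <- M] by exact: map_f.
by rewrite -E => /mapP[[y b] yb [_ fx]]; move: (f0 x xM); rewrite fx /= => ->.
Qed.

(** The mark [f i] of the common letter records word and index; the words are recovered from it, as
    without repetitions their length is at most [n]. *)
Lemma marked_inj (f : X -> J) i l M l' M' :
  marked l M = word_map (fun x => (x, f x)) M ->
  marked l' M' = word_map (fun x => (x, f x)) M' ->
  i \in wseq M -> i \in wseq M' -> (M, l) = (M', l').
Proof.
have sizele (N : word X) : uniq (wseq N) -> (size N <= n)%N.
  by move=> uN; rewrite -(card_uniqP uN) -[n in leqRHS]card_ord max_card.
move=> /marked_eqP[uM fM] /marked_eqP[uM' fM'] iM iM'.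
have := fM' _ iM'; rewrite fM // => -[E ->]; congr pair; apply: val_inj => /=.
have := congr1 (@bseqval _ _) E; rewrite /insub_bseq !insubdK //; exact: sizele.
Qed.

End WordMarking.

(** * Generating functions lie in the span *)

Section GeneratingSpan.
Variables (K : fieldType) (n d : nat).
Local Notation X := 'I_n.
Local Notation J := (bool * n.-bseq X * 'I_d)%type.
Local Notation scalars := ('I_d -> {scalar ncpoly K X}).
Variables (F : scalars -> K) (Fgen : generating F).

Definition restrict_marked (f : X -> J) (phi : scalars) : scalars :=
  fun l => malg_scalar (fun M =>
    if marked l M == word_map (fun x => (x, f x)) M then phi l << M >> else 0).

(** Scaling the letter [i] by 0 fixes the restricted functionals, since no surviving word contains
    [i], but multiplies the value of [F] by 0. *)
Lemma restrict_marked_uncovered (f : X -> J) (i : X) (phi : scalars) :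
  (forall l M, i \in wseq M -> marked l M <> word_map (fun x => (x, f x)) M) ->
  F (restrict_marked f phi) = 0.
Proof.
move=> iM.
have := generating_scale Fgen (fun x => (x != i)%:R) (restrict_marked f phi).
rewrite (bigD1 i) //= eqxx !mul0r => <-.
congr F; apply/funext => l; apply: malg_scalar_ext => M.
rewrite /= !malg_scalarU.
case: eqP => [ME|_]; last by rewrite mulr0.
rewrite big_seq big1 ?mul1r // => x xM.
by case: eqP => // xi; case: (iM l M) => //; rewrite -xi.
Qed.

Section Covered.
Variables (f : X -> J) (g : X -> word X * 'I_d).
Hypothesis g_mem : forall i, i \in wseq (g i).1.
Hypothesis g_marked : forall i,
  marked (g i).2 (g i).1 = word_map (fun x => (x, f x)) (g i).1.

Let gE i l M : marked l M = word_map (fun x => (x, f x)) M ->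
  i \in wseq M -> g i = (M, l).
Proof.
move=> ME iM; rewrite [LHS]surjective_pairing.
exact: marked_inj (g_marked i) ME (g_mem i) iM.
Qed.

Let is_head i := head i (wseq (g i).1) == i.

Let factors := [seq g i | i <- enum X & is_head i].

(* Each surviving word is listed once, at the index of its first letter. *)
Lemma covered_factors :
  perm_eq (flatten [seq wseq y.1 | y <- factors]) (enum X).
Proof.
apply/allP => x _ /=.
rewrite [X in _ == X]count_uniq_mem ?enum_uniq // mem_enum inE.
rewrite count_flatten sumnE !big_map big_filter big_mkcond big_enum /=.
(* The letter [x] is counted only in the word of [g x], which is listed at its first letter [h]. The
   default value of [head] is immaterial, as words are nonempty. *)
pose h := head x (wseq (g x).1).
have hx : h \in wseq (g x).1.
  by rewrite /h; case: (wseq _) (g_mem x) => //= y s _; rewrite mem_head.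
have gh : g h = g x by rewrite (gE (g_marked x) hx) -surjective_pairing.
rewrite (bigD1 h) //= big1 ?addn0.
  rewrite /is_head gh {1}/h.
  have -> : head h (g x).1 = head x (g x).1 by case: (wseq _) (g_mem x).
  rewrite eqxx count_uniq_mem ?g_mem //.
  by have /marked_eqP[] := g_marked x.
move=> i ih; case: ifP => // /eqP ii; apply/eqP.
rewrite -leqn0 leqNgt -has_count.
apply/negP; rewrite has_pred1 => xi.
have gx : g x = g i by rewrite (gE (g_marked i) xi) -surjective_pairing.
case/eqP: ih; rewrite -ii /h gx.
by case: (wseq _) (g_mem i).
Qed.

Lemma covered_span : span_calMd (fun phi => F (restrict_marked f phi)).
Proof.
(* With value 1 on every surviving word, [F delta] becomes the coefficient of the monomial. *)
pose delta : scalars := fun l => malg_scalar (fun M =>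
  (marked l M == word_map (fun x => (x, f x)) M)%:R).
have : calMd X d (cmprod factors).
  by apply/calMdP; exists factors => //; exact: covered_factors.
(* Rescale the first letter of each surviving word by the value of phi there. *)
move/(span_calMdU (F delta)); congr span_calMd; apply/funext => phi.
rewrite Sdual_cmprod big_map big_filter big_mkcond big_enum /= mulrC.
rewrite -generating_scale //; congr F; apply/funext => l.
apply: malg_scalar_ext => M; rewrite /= !malg_scalarU.
case: eqP => [ME|_]; last by rewrite mulr0.
rewrite mulr1; have /marked_eqP[uM _] := ME.
(* Every letter [x] of [M] has [g x = (M, l)]; as [M] has no repetitions, only its first letter
   contributes the factor [phi l << M >>]. *)
rewrite (eq_big_seq (fun x =>
  if head x (wseq M) == x then phi l << M >> else 1)).
  case: M uM {ME} => -[//|y s] i /= /andP[ys _].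
  rewrite big_cons eqxx big_seq big1 ?mulr1 // => x xs.
  by case: eqP => // yx; rewrite yx xs in ys.
by move=> x xM; rewrite /is_head (gE ME xM).
Qed.

End Covered.

Lemma generating_span_calMd : span_calMd F.
Proof.
apply: (generating_section Fgen (@marked_fst n d)).
- exact: span_calMd0.
- exact: span_calMdD.
move=> f; rewrite -[X in span_calMd X]/(fun phi => F (restrict_marked f phi)).
(* Either every letter lies in a surviving word, and [g] picks one, or some letter is uncovered. *)
have [/choice[g gP]|] := pselect (forall i, exists y : word X * 'I_d,
    i \in wseq y.1 /\ marked y.2 y.1 = word_map (fun x => (x, f x)) y.1).
  by apply: (@covered_span f g) => i; case: (gP i).
move=> /existsNP[i iN].
rewrite (_ : (fun phi => F (restrict_marked f phi)) = fun=> 0).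
  exact: span_calMd0.
apply/funext => phi; apply: (@restrict_marked_uncovered f i) => l M iM ME.
by apply: iN; exists (M, l).
Qed.

End GeneratingSpan.

(** * Coefficients, and the theorem *)

(** A polynomial in the span is supported in the finite set [calMd], so its own coefficients serve
    as [alpha]. *)
Lemma span_calMd_coefP (K : fieldType) (n d : nat)
    (F : ('I_d -> {scalar ncpoly K 'I_n}) -> K) :
  span_calMd F <-> exists alpha : {cmonom (word 'I_n * 'I_d)%type} -> K,
    forall phi, F phi =
      (\sum_(pi \in calMd 'I_n d) alpha pi * Sdual phi << pi >>)%R.
Proof.
have fin := finite_calMd 'I_n d.
split=> [[P [[k [c [u [uS PE]]]] FE]]|[alpha FE]]; last first.
  rewrite (_ : F = fun phi => \sum_(pi <- fset_set (calMd 'I_n d))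
      alpha pi * Sdual phi << pi >>); last first.
    by apply/funext => phi; rewrite FE fsbig_finite.
  have : {in (fset_set (calMd 'I_n d) : seq _), forall pi, calMd 'I_n d pi}.
    by move=> pi; rewrite in_fset_set // inE.
  elim: (enum_fset _) => [|pi s IH] sS.
    rewrite (_ : (fun phi => _) = fun=> 0); first exact: span_calMd0.
    by apply/funext => phi; rewrite big_nil.
  rewrite (_ : (fun phi => _) = fun phi => alpha pi * Sdual phi << pi >> +
      \sum_(pi <- s) alpha pi * Sdual phi << pi >>); last first.
    by apply/funext => phi; rewrite big_cons.
  apply: span_calMdD; first by apply/span_calMdU/sS; rewrite mem_head.
  by apply: IH => q qs; apply: sS; rewrite inE qs orbT.
exists (mcoeff^~ P) => phi; rewrite FE fsbig_finite //=.
have supp : (msupp P `<=` fset_set (calMd 'I_n d))%fset.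
  apply/fsubsetP => q; rewrite in_fset_set // -mcoeff_neq0 PE => qP.
  apply: contra_neqT qP => /negP qN; rewrite raddf_sum /= big1 // => i _.
  have [pi pi1 <-] := uS i; rewrite mcoeffZ mcoeffU.
  by case: eqP => [piq|_]; [case: qN; rewrite -piq inE|rewrite mulr0].
rewrite {1}(monalgEw supp) linear_sum; apply: eq_bigr => q _ /=.
by rewrite [LHS]mmapU [in RHS]/Sdual [in RHS]mmapU mul1r.
Qed.

Local Open Scope classical_set_scope.

Theorem lemma4p1 (R : realType) (n d : nat)
    (F : ('I_d -> {scalar ncpoly R[i] 'I_n}) -> R[i]) :
  (generating F <->
     exists P : {malg R[i][{cmonom (word 'I_n * 'I_d)%type}]},
       linear_span [set << pi >> | pi in calMd 'I_n d] P /\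
       forall phi, F phi = Sdual phi P) /\
  (generating F <->
     exists alpha : {cmonom (word 'I_n * 'I_d)%type} -> R[i],
       forall phi,
         F phi = \sum_(pi \in calMd 'I_n d) alpha pi * Sdual phi << pi >> /\
         \sum_(pi \in calMd 'I_n d) alpha pi * Sdual phi << pi >> =
         \sum_(pi \in calMd 'I_n d)
            alpha pi * \prod_(y <- finsupp pi) phi y.2 << y.1 >>).
Proof.
have genP : generating F <-> span_calMd F.
  by split; [exact: generating_span_calMd|exact: span_calMd_generating].
split; first exact: genP.
rewrite genP span_calMd_coefP; split=> -[alpha FE]; exists alpha => phi.
  split=> //; apply: eq_fsbigr => pi; rewrite inE => pi1.
  by rewrite /Sdual mmapU mul1r (calMd_finsupp_prod _ pi1).
by have [] := FE phi.
Qed.
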